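(* Let $K$ be a totally disconnected compact topological space and let $\mathbb{B}$ be the Boolean algebra of the clopen subsets of $K$. Then $\mathfrak{r}(K)=\mathfrak{r}(\mathbb{B})$.
   Context: All topological spaces are Hausdorff. A compact space is totally disconnected if every two different points are separated by a clopen set. The reaping number $\mathfrak{r}(K)$ of a compact space $K$ is the least cardinality of a family $\mathcal{F}$ of nonempty open subsets of $K$ such that for every two disjoint closed sets $L_1,L_2\subseteq K$ there exists $W\in\mathcal{F}$ with $W\cap L_1=\emptyset$ or $W\cap L_2=\emptyset$. The reaping number $\mathfrak{r}(\mathbb{B})$ of a Boolean algebra $\mathbb{B}$ is the least cardinality of a subset $X\subseteq\mathbb{B}\setminus\{0\}$ such that every element $a\in\mathbb{B}$ either contains an element of $X$ or is disjoint from an element of $X$. *)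

(* Defs.v *)
From HB Require Import structures.
From mathcomp Require Import all_boot all_order.
From mathcomp Require Import boolp classical_sets functions cardinality.
From mathcomp Require Import topology.

Set Implicit Arguments.
Unset Strict Implicit.
Unset Printing Implicit Defensive.

Import Order.TTheory.

Local Open Scope classical_set_scope.
Local Open Scope card_scope.

(* There is no type of cardinal numbers here: the least cardinality of a member
   of [P] is represented by a member of [P] that realizes it, and two cardinals
   are equal when their representatives are equipotent ([#=]).  If [P] is empty
   the value is [set0]; below this happens only for the empty space and for the
   trivial algebra, which have no reaping family at all. *)
Definition least_card {T : Type} (P : set (set T)) : set T :=
  xget set0 [set F | P F /\ forall G, P G -> F #<= G].

(* Cardinals are well ordered, so the representative exists as soon as [P] is
   nonempty. *)
Lemma least_cardP {T : Type} (P : set (set T)) : P !=set0 ->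
  P (least_card P) /\ forall G, P G -> least_card P #<= G.
Proof.
move=> [F0 PF0].
apply: (@xgetPex _ set0 [set F | P F /\ forall G, P G -> F #<= G]).
pose I := {F : set T | P F}.
(* partial matchings between all the members of [P] simultaneously *)
pose Q (S : set (I -> T)) := (forall f i, S f -> sval i (f i)) /\
  (forall f g i, S f -> S g -> f i = g i -> f = g).
have [|S [[Smem Sinj] Smax]] := @Zorn_bigcup (I -> T) Q.
  move=> C CQ Ctot; split.
    by move=> f i [S CS Sf]; apply: (CQ _ CS).1.
  move=> f g i [S CS Sf] [S' CS' S'g] fg.
  have [SS'|S'S] := Ctot _ _ CS CS'.
    by apply: ((CQ _ CS').2 f g i) => //; apply: SS'.
  by apply: ((CQ _ CS).2 f g i) => //; apply: S'S.
have [i iS] : exists i : I, forall y, sval i y -> exists2 f, S f & f i = y.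
  apply: contrapT => /forallNP noi.
  have /choice[y yP] : forall i : I,
      exists y, sval i y /\ forall f, S f -> f i <> y.
    move=> i; have /existsNP[y /not_implyP[iy yN]] := noi i.
    by exists y; split=> // f Sf fy; apply: yN; exists f.
  apply: (Smax (S `|` [set y])).
    split; first by move=> f Sf; left.
    by move=> /(_ y (or_intror erefl)) Sy; have [_ /(_ y Sy)] := yP (exist _ F0 PF0).
  split=> [f i [Sf|->]|f g i [Sf|->] [Sg|->] //]; first exact: Smem.
  - by have [] := yP i.
  - exact: Sinj.
  - by move=> e; have [_ /(_ f Sf)] := yP i.
  - by move=> e; have [_ /(_ g Sg)] := yP i; rewrite e.
exists (sval i); split=> [|G PG]; first exact: (svalP i).
have /choice[h hP] : forall y, exists f, sval i y -> S f /\ f i = y.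
  move=> y; have [iy|niy] := pselect (sval i y).
    by have [f Sf fy] := iS y iy; exists f.
  by exists (fun=> y).
pose j : I := exist _ G PG.
suff /injfunPex[f] : exists2 f : T -> T, set_fun (sval i) G f & set_inj (sval i) f.
  exact: inj_card_le.
exists (fun y => h y j) => [y iy|y z /set_mem iy /set_mem iz e].
  by have [Sh _] := hP y iy; have := Smem _ j Sh.
have [Sy <-] := hP y iy; have [Sz <-] := hP z iz.
by rewrite (Sinj _ _ j Sy Sz e).
Qed.

Definition reaping_family_space {K : topologicalType} (F : set (set K)) :=
  (forall W, F W -> open W /\ W !=set0) /\
  (forall L1 L2 : set K, closed L1 -> closed L2 -> L1 `&` L2 = set0 ->
    exists2 W, F W & W `&` L1 = set0 \/ W `&` L2 = set0).

Definition reaping_space (K : topologicalType) : set (set K) :=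
  least_card (@reaping_family_space K).
Arguments reaping_space : clear implicits.

(* [ctbDistrLatticeType] is the library's structure of Boolean algebras. *)
Definition reaping_family_alg {d : Order.disp_t} {B : ctbDistrLatticeType d}
    (X : set B) :=
  (forall x, X x -> x <> \bot%O) /\
  (forall a : B, exists2 x, X x & (x <= a)%O \/ (x `&` a)%O = \bot%O).

Definition reaping_alg {d : Order.disp_t} (B : ctbDistrLatticeType d) : set B :=
  least_card (@reaping_family_alg d B).
Arguments reaping_alg {d} B.

Section clopen_algebra.
Variable K : topologicalType.

Definition clopen_pred : pred (set K) := fun A => `[< clopen A >].

(* The Boolean structure is inherited from [set K], so that order, meet, join,
   bottom, top and complement are the set-theoretic ones. *)
Record clopen_alg := ClopenAlg {
  clopen_val :> set K;
  clopen_valP : clopen_pred clopen_val }.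

HB.instance Definition _ := [isSub for clopen_val].
HB.instance Definition _ := [Choice of clopen_alg by <:].

Fact clopen_meet_closed : {in clopen_pred &, forall A B, (A `&` B)%O \in clopen_pred}.
Proof. by move=> A B /asboolP cA /asboolP cB; apply/asboolP/clopenI. Qed.

Fact clopen_join_closed : {in clopen_pred &, forall A B, (A `|` B)%O \in clopen_pred}.
Proof. by move=> A B /asboolP cA /asboolP cB; apply/asboolP/clopenU. Qed.

Fact clopen_bot : \bot%O \in clopen_pred.
Proof. by apply/asboolP/clopen0. Qed.

Fact clopen_top : \top%O \in clopen_pred.
Proof. by apply/asboolP/clopenT. Qed.

HB.instance Definition _ :=
  Order.SubChoice_isTBSubLattice.Build set_display (set K) clopen_pred
    set_display clopen_alg
    clopen_meet_closed clopen_join_closed clopen_bot clopen_top.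

Fact clopen_meetUl : @left_distributive clopen_alg clopen_alg Order.meet Order.join.
Proof. by move=> A B C; apply: val_inj; exact: setIUl. Qed.

HB.instance Definition _ :=
  Order.Lattice_Meet_isDistrLattice.Build set_display clopen_alg clopen_meetUl.

Fact clopen_compl_subproof (A : clopen_alg) : clopen_pred (~` A).
Proof. by case: A => A /= /asboolP cA; apply/asboolP/clopenC. Qed.

Definition clopen_compl (A : clopen_alg) : clopen_alg :=
  ClopenAlg (clopen_compl_subproof A).

Fact clopen_joinxC (A : clopen_alg) : (A `|` clopen_compl A)%O = \top%O.
Proof. by apply: val_inj; exact: setUCr. Qed.

Fact clopen_meetxC (A : clopen_alg) : (A `&` clopen_compl A)%O = \bot%O.
Proof. by apply: val_inj; exact: setICr. Qed.

HB.instance Definition _ :=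
  Order.TBDistrLattice_hasComplement.Build set_display clopen_alg
    clopen_joinxC clopen_meetxC.

End clopen_algebra.

(* Main.v *)
Require Import Defs.
From mathcomp Require Import all_boot all_order.
From mathcomp Require Import boolp classical_sets functions cardinality.
From mathcomp Require Import topology.

Local Open Scope classical_set_scope.
Local Open Scope card_scope.

(* A reaping family of the algebra is one of the space, because disjoint closed
   sets are separated by a clopen set; conversely, shrinking each member of a
   reaping family of the space to a nonempty clopen subset gives a reaping
   family of the algebra. *)

(** Minimality on each side bounds one representative by the other, and Cantor-Bernstein concludes.
    The hypotheses also make [P] and [Q] empty together, in which case both values are the default
    [set0]. *)
Lemma least_card_eq {T U : Type} {P : set (set T)} {Q : set (set U)} :
  (forall F, P F -> exists2 X, Q X & X #<= F) ->
  (forall X, Q X -> exists2 F, P F & F #<= X) ->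
  least_card P #= least_card Q.
Proof.
move=> PQ QP; have [[F PF]|nP] := pselect (P !=set0); last first.
  have nQ : ~ (Q !=set0) by move=> [X /QP[F PF _]]; apply: nP; exists F.
  rewrite /least_card !xgetPN ?card_eq00 // => X [? _].
    by apply: nQ; exists X.
  by apply: nP; exists X.
have [X QX _] := PQ F PF.
have [PlP minP] : P (least_card P) /\ _ := least_cardP (ex_intro _ F PF).
have [QlQ minQ] : Q (least_card Q) /\ _ := least_cardP (ex_intro _ X QX).
apply/card_eqPle; split.
- by have [F' PF' F'Q] := QP _ QlQ; apply: card_le_trans (minP _ PF') F'Q.
- by have [X' QX' X'P] := PQ _ PlP; apply: card_le_trans (minQ _ QX') X'P.
Qed.

Section zero_dimensional_compact.
Context {K : topologicalType}.
Context (K_hausdorff : hausdorff_space K) (K_compact : compact [set: K]).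
Context (K_zd : zero_dimensional K).

(** Compactness upgrades clopen separation of points to a base of clopen sets. *)
Lemma clopen_nbhs_basis (x : K) (U : set K) : open U -> U x ->
  exists D : set K, [/\ clopen D, D x & D `<=` U].
Proof.
move=> oU Ux.
have [D [Dx cD] DU] := zero_dimensional_cvg K_hausdorff K_zd K_compact
  (open_nbhs_nbhs (conj oU Ux)).
by exists D.
Qed.

Lemma closed_clopen_between (L U : set K) : closed L -> open U -> L `<=` U ->
  exists D : set K, [/\ clopen D, L `<=` D & D `<=` U].
Proof.
move=> cL oU LU.
have Lcpt : compact L by exact: subclosed_compact cL K_compact _.
pose small := [set D : set K | clopen D /\ D `<=` U].
(* [small] is directed under union, so the near-covering form of compactness of
   [L] yields one member of it that contains [L]. *)
pose F := filter_from small (fun D => [set E | small E /\ D `<=` E]).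
have FF : Filter F.
  apply: filter_from_filter; first by exists set0; split=> //; exact: clopen0.
  move=> D E [cD DU] [cE EU]; exists (D `|` E).
    by split; [exact: clopenU | rewrite subUset].
  by move=> G [sG /=]; rewrite subUset => -[DG EG].
have [x Lx|E sE /= LE] := iffLR (compact_near_coveringP L) Lcpt
    (set K) F (fun D x => D x) FF.
  have [D [cD Dx DU]] := clopen_nbhs_basis x U oU (LU x Lx).
  (* Every point of the neighbourhood [D] of [x] lies in every [E] that contains [D]. *)
  exists (D, [set E | small E /\ D `<=` E]) => /=.
    by split; [apply: open_nbhs_nbhs; split=> //; exact: cD.1 | exists D].
  by move=> [y E] /= [Dy [_]]; apply.
have [cE EU] := sE; exists E; split=> //.
by apply: (LE E); split=> //; exact: subset_refl.
Qed.

Lemma reaping_family_alg_of_space (F : set (set K)) : reaping_family_space F ->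
  exists2 X : set (clopen_alg K), reaping_family_alg X & X #<= F.
Proof.
move=> [F0 Freap].
(* [C W] is a nonempty clopen subset of [W]; outside [F] its value is irrelevant. *)
have /choice[C CP] : forall W : set K, exists c : clopen_alg K,
    F W -> (c : set K) !=set0 /\ c `<=` W.
  move=> W; have [FW|nFW] := pselect (F W); last by exists \bot%O.
  have [oW [x Wx]] := F0 W FW.
  have [D [/asboolP cD Dx DW]] := clopen_nbhs_basis x W oW Wx.
  by exists (@ClopenAlg K D cD) => _; split=> //; exists x.
exists (C @` F); last exact: card_image_le.
split=> [_ [W FW <-] /(congr1 (@clopen_val K)) C0|a].
  by have [[x Cx] _] := CP W FW; rewrite C0 in Cx.
have /asboolP[oa ca] := clopen_valP a.
(* Since [a] is clopen, [a] and its complement are disjoint closed sets: if [W] misses [a], then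
   [C W] is disjoint from [a]; if [W] misses the complement, then [C W] lies below [a]. *)
have [|W FW Wdisj] := Freap a (~` a) ca _ (setICr _).
  exact: open_closedC.
have [_ CW] := CP W FW.
exists (C W); first by exists W.
case: Wdisj => [W0|W0]; [right|left].
  apply/val_inj/seteqP; split=> // y [/CW Wy ay].
  by have : (W `&` a) y by []; rewrite W0.
apply/subsetPset; apply: subset_trans CW _.
by rewrite -[X in _ `<=` X]setCK -disjoints_subset.
Qed.

Lemma reaping_family_space_of_alg (X : set (clopen_alg K)) :
  reaping_family_alg X ->
  exists2 F : set (set K), reaping_family_space F & F #<= X.
Proof.
move=> [X0 Xreap].
exists (@clopen_val K @` X); last exact: card_image_le.
split=> [_ [x Xx <-]|L1 L2 cL1 cL2 L12].
  have /asboolP[ox _] := clopen_valP x; split=> //.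
  by apply/set0P/eqP => x0; apply: (X0 x Xx); apply: val_inj.
(* A member of [X] below [D] misses [L2], and one disjoint from [D] misses [L1]. *)
have [||D [/asboolP cD L1D DL2]] := closed_clopen_between L1 (~` L2) cL1.
- exact: closed_openC.
- by rewrite -disjoints_subset.
have [x Xx xD] := Xreap (@ClopenAlg K D cD).
exists x; first by exists x.
case: xD => [/subsetPset xD|/(congr1 (@clopen_val K)) xD]; [right|left].
  by rewrite disjoints_subset; apply: subset_trans xD DL2.
apply/seteqP; split=> // y [xy /L1D Dy].
by have : (x `&` D) y by []; rewrite [X in X y]xD.
Qed.

End zero_dimensional_compact.

(* [zero_dimensional K]: any two distinct points are separated by a clopen set;
   the library's [totally_disconnected] speaks of connected components instead. *)
Theorem proposition5p1 (K : topologicalType)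
    (K_hausdorff : hausdorff_space K)
    (K_compact : compact [set: K])
    (K_tot_disc : zero_dimensional K) :
  reaping_space K #= reaping_alg (clopen_alg K).
Proof.
apply: least_card_eq.
- exact: reaping_family_alg_of_space.
- exact: reaping_family_space_of_alg.
Qed.
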